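(* Let $\mathfrak C$ be a left cancellative small category. The following are equivalent: (a) $\partial\Omega$ is the smallest non-empty closed invariant subspace of $\widehat{\mathcal J}$; (b) $\partial\Omega$ is the smallest non-empty closed invariant subspace of $\Omega$; (c) for all $\mathfrak v,\mathfrak w\in\mathfrak C^0$ we have $\mathfrak w\mathfrak C\mathfrak v\ne\emptyset$. In that case, $I_l\ltimes\partial\Omega$ is purely infinite (in the sense of Matui) if and only if for all $\mathfrak v\in\mathfrak C^0$ there exist $a,b\in\mathfrak v\mathfrak C$ with $a\mathfrak C\cap b\mathfrak C=\emptyset$.
   Context: $\mathfrak C$ denotes the set of morphisms, $\mathfrak C^0\subseteq\mathfrak C$ the identity morphisms (identified with objects), $\mathfrak d,\mathfrak t$ domain and target; $cd$ is defined iff $\mathfrak d(c)=\mathfrak t(d)$; left cancellative means $cx=cy\Rightarrow x=y$. $c\mathfrak C=\{cx:\mathfrak t(x)=\mathfrak d(c)\}$, and $\mathfrak w\mathfrak C\mathfrak v$ is the set of $x$ with $\mathfrak t(x)=\mathfrak w$, $\mathfrak d(x)=\mathfrak v$. Each $c\in\mathfrak C$ gives the partial bijection $\mathfrak d(c)\mathfrak C\to c\mathfrak C$, $x\mapsto cx$; $I_l$ is the smallest semigroup of partial bijections of $\mathfrak C$ containing these and closed under inverses; $\mathcal J=\{\mathrm{dom}(s):s\in I_l\}$ is its semilattice of idempotents (product = intersection). $\widehat{\mathcal J}$ is the space of non-zero multiplicative maps $\chi:\mathcal J\to\{0,1\}$ with $\chi(\emptyset)=0$ if $\emptyset\in\mathcal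 J$ (pointwise convergence). $\Omega\subseteq\widehat{\mathcal J}$ consists of those $\chi$ such that whenever $e=\bigcup_{i=1}^nf_i$ ($e,f_i\in\mathcal J$) and $\chi(e)=1$, then $\chi(f_i)=1$ for some $i$. $\partial\Omega\subseteq\Omega$ is the closure of the set of $\chi\in\widehat{\mathcal J}$ with $\chi^{-1}(1)$ maximal. $s\in I_l$ acts by $\chi\mapsto s.\chi=\chi(s^{-1}\cdot s)$ from $\{\chi(s^{-1}s)=1\}$ onto $\{\chi(ss^{-1})=1\}$; $\Omega$ and $\partial\Omega$ are invariant. Invariant subspaces are subsets closed under this partial action. $I_l\ltimes\partial\Omega$ is the transformation groupoid: classes $[s,\chi]$ with $\chi\in\partial\Omega$, $\chi(s^{-1}s)=1$, $[s,\chi]=[t,\chi]$ iff $se=te$ for some $e\in\mathcal J$ with $\chi(e)=1$; source $\chi$, range $s.\chi$; topology such that $\{[s,\chi]:\chi(s^{-1}s)=1\}$ is open and mapped homeomorphically by the source map onto $\{\chi\in\partial\Omega:\chi(s^{-1}s)=1\}$. An étale groupoid $\mathcal G$ with totally disconnected locally compact Hausdorff unit space is purely infinite (Matui) if for every compact open $B\subseteq\mathcal G^{(0)}$ there are compact open bisections $U,V\subseteq\mathcal G$ with $\mathrm s(U)=\mathrm s(V)=B$, $\mathrm r(U)\cup\mathrm r(V)\subseteq B$ and $\mathrm r(U)\cap\mathrm r(V)=\emptyset$. *)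

(* Defs.v *)
From HB Require Import structures.
From mathcomp Require Import all_boot generic_quotient.
From mathcomp Require Import mathcomp_extra boolp classical_sets functions topology.

Set Implicit Arguments.
Unset Strict Implicit.
Unset Printing Implicit Defensive.

Local Open Scope classical_set_scope.
Local Open Scope quotient_scope.
Local Open Scope relation_scope.

Definition to_set_type (T : Type) (A : set T) (x : T) (Ax : A x) : A :=
  exist (fun y => y \in A) x (mem_set Ax).

(* A small category is given by its set of morphisms, objects being identified
   with identity morphisms, i.e. with the fixed points of cdom (equivalently of
   ctgt). The product cmul c d is meaningful only when cdom c = ctgt d: its
   values on other pairs are unconstrained and are never used below. *)
Record small_category := SmallCategory {
  mor :> Type;
  cdom : mor -> mor;
  ctgt : mor -> mor;
  cmul : mor -> mor -> mor;
  ctgt_cdom : forall c, ctgt (cdom c) = cdom c;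
  cdom_ctgt : forall c, cdom (ctgt c) = ctgt c;
  cmul_cdom : forall c, cmul c (cdom c) = c;
  cmul_ctgt : forall c, cmul (ctgt c) c = c;
  cdom_cmul : forall c d, cdom c = ctgt d -> cdom (cmul c d) = cdom d;
  ctgt_cmul : forall c d, cdom c = ctgt d -> ctgt (cmul c d) = ctgt c;
  cmulA : forall b c d, cdom b = ctgt c -> cdom c = ctgt d ->
    cmul b (cmul c d) = cmul (cmul b c) d }.

Definition left_cancellative (C : small_category) : Prop :=
  forall c x y : C, cdom c = ctgt x -> cdom c = ctgt y ->
    cmul c x = cmul c y -> x = y.

Record lc_category := LcCategory {
  lc_cat :> small_category;
  lc_cancel : left_cancellative lc_cat }.

Definition objects (C : small_category) : set C := [set v | cdom v = v].

Arguments objects : clear implicits.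

Definition right_ideal (C : small_category) (c : C) : set C :=
  [set cmul c x | x in [set x | ctgt x = cdom c]].

Definition hom (C : small_category) (w v : C) : set C :=
  [set x | ctgt x = w /\ cdom x = v].

(* Partial bijections of C are represented by their graphs. Note that
   s \; t is the composite st: first t, then s. *)

Definition lmul (C : small_category) (c : C) : set (C * C) :=
  [set p | ctgt p.1 = cdom c /\ p.2 = cmul c p.1].

(* the left inverse hull I_l *)
Inductive Il (C : small_category) : set (set (C * C)) :=
| Il_lmul c : Il (lmul c)
| Il_comp s t :
    Il s -> Il t -> Il (s \; t)
| Il_inv s : Il s -> Il (s^-1).

Arguments Il : clear implicits.

(* The idempotents of Il are the identities of the members of J; they are
   identified with these members. *)
Definition J (C : small_category) : set (set C) := [set s.`1 | s in Il C].

Arguments J : clear implicits.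

Definition pid (T : Type) (e : set T) : set (T * T) :=
  [set p | e p.1 /\ p.2 = p.1].

Section LeftInverseHull.
Variable C : lc_category.
Implicit Types (s t : Il C) (e f : J C).

Lemma Il_pbij (s : set (C * C)) : Il C s ->
  (forall x y z, s (x, y) -> s (x, z) -> y = z) /\
  (forall x y z, s (x, z) -> s (y, z) -> x = y).
Proof.
elim=> [c|{}s t _ [sf si] _ [tf ti]|{}s _ [sf si]].
- split=> x y z [/= tx ->] [/= ty]; first by [].
  exact/lc_cancel.
- split=> x y z /= [u /= xu uy] [v /= xv vz].
    by rewrite (tf _ _ _ xu xv) in uy; exact: (sf _ _ _ uy vz).
  by rewrite (si _ _ _ uy vz) in xu; exact: (ti _ _ _ xu xv).
- by split=> x y z /= xz yz; [exact: (si _ _ _ xz yz)|exact: (sf _ _ _ xz yz)].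
Qed.

Lemma Il_fun s x y z : \val s (x, y) -> \val s (x, z) -> y = z.
Proof. by have [+ _] := Il_pbij (set_mem (valP s)); exact. Qed.

Lemma Il_inj s x y z : \val s (x, z) -> \val s (y, z) -> x = y.
Proof. by have [_ +] := Il_pbij (set_mem (valP s)); exact. Qed.

Lemma J_ext e f : (forall x, \val e x <-> \val f x) -> e = f.
Proof. by move=> ef; apply/val_inj/seteqP; split=> x /ef. Qed.

Lemma J_pid e : Il C (pid (\val e)).
Proof.
have [s Is es] := set_mem (valP e).
have [_ si] := Il_pbij Is.
suff -> : pid (\val e) = s^-1 \; s by apply: Il_comp => //; exact: Il_inv.
rewrite -es; apply/seteqP; split=> -[x y] /=.
  by move=> [[z xz] /= ->]; exists z.
by move=> [z /= xz yz]; split; [exists z|exact: (si _ _ _ yz xz)].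
Qed.

(* the domain of s, identified with the idempotent s^-1 s *)
Definition Jdom s : J C := to_set_type (imageP (@fst_set C C) (set_mem (valP s))).

Definition sinv s : Il C := to_set_type (Il_inv (set_mem (valP s))).

Lemma Jmeet_subproof e f : J C (\val e `&` \val f).
Proof.
exists (pid (\val e) \; pid (\val f)).
  by apply: Il_comp; exact: J_pid.
apply/seteqP; split=> x /=; first by move=> [y [z [/= ex ->] [/= fx _]]].
by move=> [ex fx]; exists x, x.
Qed.

Definition Jmeet e f : J C := to_set_type (Jmeet_subproof e f).

Lemma Jconj_subproof s e :
  J C ((\val s)^-1 \; pid (\val e) \; \val s).`1.
Proof.
apply: imageP; apply: Il_comp; first exact/Il_inv/set_mem/valP.
by apply: Il_comp; [exact: J_pid|exact/set_mem/valP].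
Qed.

(* s^-1 e s *)
Definition Jconj s e : J C := to_set_type (Jconj_subproof s e).

Lemma JconjE s e x : \val (Jconj s e) x <-> exists2 y, \val s (x, y) & \val e y.
Proof.
split=> /=.
  by move=> [y [z /= [w /= xw [/= ew _]] _]]; exists w.
by move=> [y xy ey]; exists x, y => //=; exists y.
Qed.

Lemma Jconj_meet s e f : Jconj s (Jmeet e f) = Jmeet (Jconj s e) (Jconj s f).
Proof.
apply: J_ext => x; split.
  by move=> /JconjE[y xy [ey fy]]; split; apply/JconjE; exists y.
move=> [/JconjE[y xy ey] /JconjE[z xz fz]]; apply/JconjE; exists y => //.
by split=> //; rewrite (Il_fun xy xz).
Qed.

Lemma Jconj_dom_inv s : Jconj s (Jdom (sinv s)) = Jdom s.
Proof.
apply: J_ext => x; split; first by move=> /JconjE[y xy _]; exists y.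
by move=> [y xy]; apply/JconjE; exists y => //; exists x.
Qed.

Lemma Jconj_inv s e : Jconj s (Jconj (sinv s) e) = Jmeet e (Jdom s).
Proof.
apply: J_ext => x; split.
  move=> /JconjE[y xy /JconjE[z /= zy ez]].
  by rewrite -(Il_inj zy xy); split=> //; exists y.
move=> [ex [y xy]]; apply/JconjE; exists y => //.
by apply/JconjE; exists x.
Qed.

Lemma sinvK s : sinv (sinv s) = s.
Proof. by apply/val_inj/seteqP; split=> -[]. Qed.

Definition Jhat : set {ptws J C -> bool} :=
  [set chi : J C -> bool | [/\ exists e, chi e,
    forall e f, chi (Jmeet e f) = chi e && chi f
    & forall e, \val e = set0 -> chi e = false]].

(* chi^-1(1) *)
Definition supp (chi : Jhat) : set (J C) := [set e : J C | \val chi e].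

Definition Omega : set Jhat :=
  [set chi : Jhat | forall (e : J C) (n : nat) (f : 'I_n -> J C),
    \val e = \bigcup_i \val (f i) -> \val chi e -> exists i, \val chi (f i)].

Definition maximal_chars : set Jhat :=
  [set chi : Jhat | forall psi : Jhat, supp chi `<=` supp psi -> supp psi = supp chi].

Definition dOmega : set Jhat := closure maximal_chars.

Lemma act_subproof s (chi : Jhat) :
  \val chi (Jdom s) -> Jhat (fun e => \val chi (Jconj s e)).
Proof.
move=> chis; have [_ chiM chi0] := set_mem (valP chi); split.
- by exists (Jdom (sinv s)); rewrite Jconj_dom_inv.
- by move=> e f; rewrite Jconj_meet chiM.
- move=> e e0; apply: chi0; apply/seteqP; split=> x // /JconjE[y _].
  by rewrite e0.
Qed.

(* s.chi *)
Definition act s (chi : Jhat) (h : \val chi (Jdom s)) : Jhat :=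
  to_set_type (act_subproof h).

Definition invariant (X : set Jhat) : Prop :=
  forall s (chi : Jhat) (h : \val chi (Jdom s)), X chi -> X (act h).

(* closedness is relative to the subspace Y of Jhat *)
Definition closed_invariant_subspace (Y : set Jhat) : set (set Jhat) :=
  [set X | (exists2 F, closed F & X = F `&` Y) /\ invariant X].

Definition smallest_nonempty_closed_invariant (Y Z : set Jhat) : Prop :=
  [/\ Z !=set0, closed_invariant_subspace Y Z
    & forall X, X !=set0 -> closed_invariant_subspace Y X -> Z `<=` X].

Lemma maximal_chars_invariant : invariant maximal_chars.
Proof.
move=> s chi h maxchi psi le_psi.
have [_ chiM _] := set_mem (valP chi).
have [_ psiM _] := set_mem (valP psi).
have psis : \val psi (Jdom (sinv s)).
  by apply: le_psi; rewrite /supp /= Jconj_dom_inv.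
have eqchi : supp (act psis) = supp chi.
  apply: maxchi => e chie; apply: le_psi.
  by rewrite /supp /= Jconj_inv chiM chie.
apply/seteqP; split=> // f psif.
have : supp (act psis) (Jconj s f).
  rewrite /supp /=; have := Jconj_inv (sinv s) f; rewrite sinvK => ->.
  by rewrite psiM psis andbT.
by rewrite eqchi.
Qed.

Lemma dOmega_invariant : invariant dOmega.
Proof.
move=> s chi h chiO B.
rewrite nbhsE => -[_ [[W oW <-] Wchi] WB].
pose F (psi : {ptws J C -> bool}) : {ptws J C -> bool} :=
  fun e => psi (Jconj s e).
have Fc : continuous F.
  move=> psi; apply/cvg_sup => e U [V] [[D oD <-] Dpsi] DU.
  apply: (filterS DU); apply: (@proj_continuous (J C) (fun=> bool) (Jconj s e)).
  exact: open_nbhs_nbhs.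
have evs : open [set psi : {ptws J C -> bool} | psi (Jdom s)].
  apply: (@open_comp {ptws J C -> bool} bool (proj (Jdom s)) [set b : bool | b]).
    by move=> psi _; exact: proj_continuous.
  exact: discrete_open.
have [] := chiO [set psi : Jhat | \val psi (Jdom s) /\ W (F (\val psi))].
  apply: open_nbhs_nbhs; split=> //.
  exists ([set psi : {ptws J C -> bool} | psi (Jdom s)] `&` F @^-1` W) => //.
  by apply: openI => //; apply: open_comp.
move=> psi [maxpsi [psis Wpsi]]; exists (act psis); split; last exact: WB.
exact: maximal_chars_invariant.
Qed.

Lemma act_ext s t (chi psi : Jhat) (h : \val chi (Jdom s))
    (k : \val psi (Jdom t)) :
  chi = psi ->
  (exists2 e : J C, \val chi e & \val s \; pid (\val e) = \val t \; pid (\val e)) ->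
  act h = act k.
Proof.
move=> chipsi [e chie ste]; case: _ / chipsi in k *.
have [_ chiM _] := set_mem (valP chi).
have sub (u v : Il C) : \val u \; pid (\val e) = \val v \; pid (\val e) ->
    forall f x, \val (Jconj u f) x -> \val e x -> \val (Jconj v f) x.
  move=> uv f x /JconjE[y xy fy] ex.
  have : (\val u \; pid (\val e)) (x, y) by exists x.
  by rewrite uv => -[z [_ /= ->] zy]; apply/JconjE; exists y.
apply/val_inj/funext => f /=.
rewrite -[LHS]andbT -[RHS]andbT -chie -!chiM; congr (\val chi _).
by apply: J_ext => x; split=> -[/= fx ex]; split=> //; exact: (sub _ _ _ _ _ fx).
Qed.

(* The groupoid of germs of the action of Il on dOmega, with unit space
   dOmega. *)

Definition germ_rep : set (Il C * dOmega) :=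
  [set p : Il C * dOmega | \val (\val p.2) (Jdom p.1)].

Definition germ_eq (p q : germ_rep) : bool :=
  `[< (\val p).2 = (\val q).2 /\
      exists2 e : J C, \val (\val (\val p).2) e
        & \val (\val p).1 \; pid (\val e) = \val (\val q).1 \; pid (\val e) >].

Lemma germ_eqP (p q : germ_rep) : germ_eq p q <->
  (\val p).2 = (\val q).2 /\
  exists2 e : J C, \val (\val (\val p).2) e
    & \val (\val p).1 \; pid (\val e) = \val (\val q).1 \; pid (\val e).
Proof. by split=> /asboolP. Qed.

Lemma comp_pidE (s : set (C * C)) (e : set C) :
  s \; pid e = [set p | e p.1 /\ s p].
Proof.
apply/seteqP; split=> -[x y] /=.
  by move=> [z [/= ex ->] xy].
by move=> [ex xy]; exists x.
Qed.

Lemma germ_eq_refl : reflexive germ_eq.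
Proof.
move=> p; apply/germ_eqP; split=> //; exists (Jdom (\val p).1) => //.
exact: (set_mem (valP p)).
Qed.

Lemma germ_eq_sym : symmetric germ_eq.
Proof.
suff sub p q : germ_eq p q -> germ_eq q p by move=> p q; apply/idP/idP => /sub.
move=> /germ_eqP[pq [e pe epq]]; apply/germ_eqP; split=> //.
by exists e => //; rewrite -pq.
Qed.

Lemma germ_eq_trans : transitive germ_eq.
Proof.
move=> q p r /germ_eqP[pq [e pe epq]] /germ_eqP[qr [f qf fqr]].
apply/germ_eqP; split; first by rewrite pq.
have [_ chiM _] := set_mem (valP (\val (\val p).2)).
exists (Jmeet e f); first by rewrite chiM pe pq qf.
move: epq fqr; rewrite !comp_pidE => /seteqP[e1 e2] /seteqP[f1 f2].
apply/seteqP; split=> -[x y] [/= [ex fx] xy]; split=> //=.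
  by have [|_ xy'] := e1 (x, y); [split|have [|_] := f1 (x, y); [split|]].
by have [|_ xy'] := f2 (x, y); [split|have [|_] := e2 (x, y); [split|]].
Qed.

Canonical germ_equiv := EquivRel germ_eq germ_eq_refl germ_eq_sym germ_eq_trans.

Definition transformation_groupoid := {eq_quot germ_equiv}.

HB.instance Definition _ := Choice.on transformation_groupoid.
HB.instance Definition _ := EqQuotient.on transformation_groupoid.

(* the germ [s, chi] *)
Definition germ s (chi : dOmega) (h : \val (\val chi) (Jdom s)) :
    transformation_groupoid :=
  \pi_transformation_groupoid (to_set_type (h : germ_rep (s, chi))).

Lemma germP s t (chi psi : dOmega) (h : \val (\val chi) (Jdom s))
    (k : \val (\val psi) (Jdom t)) :
  germ h = germ k <-> chi = psi /\ exists2 e : J C, \val (\val chi) e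
    & \val s \; pid (\val e) = \val t \; pid (\val e).
Proof.
split; first by move=> /eqmodP/germ_eqP.
by move=> hk; apply/eqmodP/germ_eqP.
Qed.

Definition germ_source (g : transformation_groupoid) : dOmega :=
  (\val (repr g)).2.

Definition act_dOmega s (chi : dOmega) (h : \val (\val chi) (Jdom s)) : dOmega :=
  to_set_type (@dOmega_invariant s _ h (set_mem (valP chi))).

Definition germ_range (g : transformation_groupoid) : dOmega :=
  act_dOmega (set_mem (valP (repr g))).

Lemma germ_sourceE s (chi : dOmega) (h : \val (\val chi) (Jdom s)) :
  germ_source (germ h) = chi.
Proof.
have : \pi_transformation_groupoid (repr (germ h)) = germ h by rewrite reprK.
by move=> /eqmodP/germ_eqP[].
Qed.

Lemma germ_rangeE s (chi : dOmega) (h : \val (\val chi) (Jdom s)) :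
  germ_range (germ h) = act_dOmega h.
Proof.
have : \pi_transformation_groupoid (repr (germ h)) = germ h by rewrite reprK.
move=> /eqmodP/germ_eqP[chiE gh]; apply/val_inj/act_ext => //.
by congr \val.
Qed.

(* The chi in dOmega such that [s, chi] is defined and belongs to W, i.e. the
   image under the source map of the intersection of W with the set of all
   [s, chi]. *)
Definition germ_trace (W : set transformation_groupoid) s : set dOmega :=
  [set chi : dOmega | exists h : \val (\val chi) (Jdom s), W (germ h)].

(* The unique topology such that, for every s, the set of all [s, chi] is open
   and mapped homeomorphically by the source map onto an open subset. *)
Definition germ_open : set_system transformation_groupoid :=
  [set W | forall s, open (germ_trace W s)].

Lemma open_Jhat_eval (e : J C) : open [set chi : dOmega | \val (\val chi) e].
Proof.
exists [set chi : Jhat | \val chi e] => //.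
exists [set psi : {ptws J C -> bool} | psi e] => //.
apply: (@open_comp {ptws J C -> bool} bool (proj e) [set b : bool | b]).
  by move=> psi _; exact: proj_continuous.
exact: discrete_open.
Qed.

Lemma germ_openT : germ_open setT.
Proof.
move=> s; suff -> : germ_trace setT s = [set chi : dOmega | \val (\val chi) (Jdom s)].
  exact: open_Jhat_eval.
by apply/seteqP; split=> chi [] // h; exists h.
Qed.

Lemma germ_openI : setI_closed germ_open.
Proof.
move=> V W oV oW s.
suff -> : germ_trace (V `&` W) s = germ_trace V s `&` germ_trace W s.
  exact: openI.
apply/seteqP; split=> chi; first by move=> [h [Vh Wh]]; split; exists h.
by move=> [[h Vh] [k Wk]]; exists h; rewrite (bool_irrelevance k h) in Wk.
Qed.

Lemma germ_open_bigU (I : Type) (W : I -> set transformation_groupoid) :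
  (forall i, germ_open (W i)) -> germ_open (\bigcup_i W i).
Proof.
move=> oW s.
suff -> : germ_trace (\bigcup_i W i) s = \bigcup_i germ_trace (W i) s.
  by apply: bigcup_open => i _; exact: oW.
apply/seteqP; split=> chi.
  by move=> [h [i _ Wh]]; exists i => //; exists h.
by move=> [i _ [h Wh]]; exists h; exists i.
Qed.

HB.instance Definition _ := isOpenTopological.Build transformation_groupoid
  germ_openT germ_openI germ_open_bigU.

Lemma germ_openE (W : set transformation_groupoid) :
  open W = (forall s, open (germ_trace W s)).
Proof. by []. Qed.

Definition germs s : set transformation_groupoid :=
  [set g | exists (chi : dOmega) (h : \val (\val chi) (Jdom s)), g = germ h].

Lemma germ_trace_source s W : W `<=` germs s ->
  germ_trace W s = germ_source @` W.
Proof.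
move=> Ws; apply/seteqP; split=> chi.
  by move=> [h Wh]; exists (germ h) => //; exact: germ_sourceE.
move=> [g Wg <-]; have [psi [h gE]] := Ws _ Wg.
by move: Wg; rewrite gE germ_sourceE => Wg; exists h.
Qed.

Lemma open_sub_germs s W : W `<=` germs s ->
  open W <-> open (germ_source @` W).
Proof.
move=> Ws; rewrite -(germ_trace_source Ws); rewrite germ_openE.
split=> [oW|oW t]; first exact: oW.
pose E := [set e : J C | \val s \; pid (\val e) = \val t \; pid (\val e)].
suff -> : germ_trace W t = germ_trace W s `&`
    ([set chi : dOmega | \val (\val chi) (Jdom t)] `&`
     \bigcup_(e in E) [set chi : dOmega | \val (\val chi) e]).
  apply: openI => //; apply: openI; first exact: open_Jhat_eval.
  by apply: bigcup_open => e _; exact: open_Jhat_eval.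
apply/seteqP; split=> chi.
  move=> [k Wk]; have [psi [h kh]] := Ws _ Wk.
  have /germP[chipsi [e chie ts]] := kh.
  case: _ / chipsi in h kh *.
  by split; [exists h; rewrite -kh|split=> //; exists e].
move=> [[h Wh] [k [e st chie]]]; exists k.
by suff <- : germ h = germ k by []; apply/germP; split=> //; exists e.
Qed.

Lemma germ_source_inj s : set_inj (germs s) germ_source.
Proof.
move=> _ _ /set_mem[chi [h ->]] /set_mem[psi [k ->]].
rewrite !germ_sourceE => chipsi; apply/germP; split=> //.
by exists (Jdom s).
Qed.

Lemma open_germs s : open (germs s).
Proof.
apply/(@open_sub_germs s) => //; rewrite -(@germ_trace_source s) //.
suff -> : germ_trace (germs s) s = [set chi : dOmega | \val (\val chi) (Jdom s)].
  exact: open_Jhat_eval.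
apply/seteqP; split=> chi; first by move=> [].
by move=> h; exists h; exists chi, h.
Qed.

End LeftInverseHull.

Arguments Jhat : clear implicits.
Arguments Omega : clear implicits.
Arguments dOmega : clear implicits.
Arguments transformation_groupoid : clear implicits.

Section PurelyInfinite.
(* G is the arrow space and X the unit space of an etale groupoid with source
   map src and range map rng; its product does not enter the definition. For
   open sets of arrows, being a bisection amounts to injectivity of both maps,
   which are local homeomorphisms. G need not be Hausdorff. *)
Variables (G X : topologicalType) (src rng : G -> X).

Definition compact_open_bisection (U : set G) : Prop :=
  [/\ compact U, open U, set_inj U src & set_inj U rng].

Definition purely_infinite : Prop :=
  forall B : set X, compact B -> open B ->
    exists U V : set G,
      [/\ compact_open_bisection U /\ compact_open_bisection V,
          src @` U = B, src @` V = B,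
          rng @` U `|` rng @` V `<=` B & rng @` U `&` rng @` V = set0].

End PurelyInfinite.

(* Main.v *)
Require Import Defs.
From mathcomp Require Import all_boot.
From mathcomp Require Import boolp classical_sets functions cardinality topology.

Set Implicit Arguments.
Unset Strict Implicit.
Unset Printing Implicit Defensive.

Local Open Scope classical_set_scope.
Local Open Scope relation_scope.

(** A character of [J] is a filter of non-empty right ideals; write [D(e)] for
the characters of value 1 at [e]. A maximal filter that omits [f] contains an
ideal disjoint from [f], so the sets [D(e)], without negative conditions,
already form a neighbourhood base at a maximal character
([maximal_char_nbhs]). As maximal characters are dense in the boundary, every
non-empty open subset of the boundary contains the boundary part of some
[D(e)] with [e] non-empty ([dOmega_nbhs_ideal]), hence of [D(cC)] for any [c]
in [e].

Every character has value 1 at the ideal [wC] of exactly one object [w]. If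
every two objects are joined by morphisms, take [c] in [e] and [x] from [w] to
the domain of [c]: left multiplication by [cx] has domain [wC] and range in
[e], so it moves any character living at [w] into [D(e)]
([orbit_meets]). All orbits are then dense at maximal characters, and the
boundary is the smallest closed invariant set. Conversely, the principal
character at [v], i.e. the filter of ideals containing [v], is moved into
[D(wC)] only by an element of the hull sending [v] to a morphism from [v] to
[w]; without such a morphism, the characters with no translate in [D(wC)] form
a non-empty closed invariant subset of Omega that misses every maximal
character of [D(wC)] ([strongly_connected_of_smallest]).

For pure infiniteness, a compact open set [B] of the boundary meets [D(wC)]
for finitely many objects [w] only, since these sets are open and disjoint. If
[B] is non-empty, it contains the boundary part of some [D(cC)], and
repeated branching gives infinitely many disjoint ideals inside [cC]. Moving
each piece of [B] into one of these ideals by a left multiplication, and then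
again into fresh ideals, yields the two bisections
([purely_infinite_of_disjoint_multiples]). Conversely [D(vC)] is a
compact open part of the boundary, so pure infiniteness provides two distinct
points in it, and separating them provides the disjoint ideals
([disjoint_multiples_of_purely_infinite]). *)

(** * Topological preliminaries *)

Lemma nbhs_set_type (T : topologicalType) (A : set T) (x : A) (B : set A) :
  nbhs x B <-> exists2 W, nbhs (\val x) W & forall y : A, W (\val y) -> B y.
Proof.
split.
  move=> [_ [[W oW <-] Wx] WB]; exists W; first exact: open_nbhs_nbhs.
  by move=> y Wy; exact: WB.
move=> [W Wx WB]; have : nbhs x (\val @^-1` W) by exact: initial_continuous.
by apply: filterS => y; exact: WB.
Qed.

(** With infinitely many values, the complements of finite sets of values would
pull back to a filter on [K] without cluster point. *)
Lemma compact_locally_constant (X : topologicalType) (T : Type) (K : set X)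
    (f : X -> T) :
  compact K -> (forall x, \forall y \near x, f y = f x) -> finite_set (f @` K).
Proof.
move=> cK fc; apply: contrapT => infK.
pose F := filter_from (@finite_set T) (fun S => K `&` f @^-1` ~` S).
have Ff : Filter F.
  apply: filter_from_filter; first by exists set0.
  move=> S S' fS fS'; exists (S `|` S'); first by rewrite finite_setU.
  move=> x [Kx] /not_orP[Sx S'x]; by split; split.
have Fp : ProperFilter F.
  apply: filter_from_proper => S fS; apply: contrapT => KS.
  apply: infK; apply: sub_finite_set fS => _ [x Kx <-].
  by apply: contrapT => Sx; apply: KS; exists x.
have [|x [Kx /(_ (~` (f @^-1` [set f x])) _ _ (fc x))]] := cK F Fp.
  by exists set0 => // x [].
case; last by move=> y [].
by exists [set f x] => // y [].
Qed.

(** * Right ideals and the left inverse hull *)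

Section Category.
Variable C : lc_category.
Implicit Types (c d x y z v w : C) (s t : Il C) (e f g : J C).

Lemma objects_cdom c : objects C (cdom c).
Proof. by rewrite /objects /= -[cdom c in LHS]ctgt_cdom cdom_ctgt ctgt_cdom. Qed.

Lemma objects_ctgt c : objects C (ctgt c).
Proof. exact: cdom_ctgt. Qed.

Lemma ctgt_object v : objects C v -> ctgt v = v.
Proof. by move=> /= vE; rewrite -vE ctgt_cdom. Qed.

Lemma right_ideal_object v x : objects C v -> right_ideal v x <-> ctgt x = v.
Proof.
move=> vO; split; first by move=> [y /= yv <-]; rewrite ctgt_cmul // ctgt_object.
by move=> xv; exists x; rewrite /= ?vO // -xv cmul_ctgt.
Qed.

Lemma right_ideal_refl c : right_ideal c c.
Proof. by exists (cdom c); rewrite /= ?ctgt_cdom// cmul_cdom. Qed.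

Lemma right_ideal_trans c d : right_ideal c d -> right_ideal d `<=` right_ideal c.
Proof.
move=> [x /= xc <-] _ [y /= yx <-]; rewrite cdom_cmul // in yx.
by exists (cmul x y); rewrite /= ?ctgt_cmul ?cmulA.
Qed.

Lemma right_ideal_cmul c d : ctgt d = cdom c -> right_ideal c (cmul c d).
Proof. by move=> dc; exists d. Qed.

Lemma cmul_right_ideals_disjoint c a b : ctgt a = cdom c -> ctgt b = cdom c ->
  right_ideal a `&` right_ideal b = set0 ->
  right_ideal (cmul c a) `&` right_ideal (cmul c b) = set0.
Proof.
move=> ac bc ab0; apply/seteqP; split=> // _ [[x /= xa <-] [y /= yb]].
rewrite cdom_cmul // in xa; rewrite cdom_cmul // in yb.
rewrite -!cmulA // => /lc_cancel cE.
have : (right_ideal a `&` right_ideal b) (cmul a x).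
  split; first exact: right_ideal_cmul.
  by rewrite -cE ?ctgt_cmul //; exact: right_ideal_cmul.
by rewrite ab0.
Qed.

Lemma Il_cdom s x y : \val s (x, y) -> cdom y = cdom x.
Proof.
have := set_mem (valP s); move: (\val s) => u Iu.
elim: Iu x y => {s u} [c|s t _ IHs _ IHt|s _ IHs] x y /=.
- by move=> [/= xc ->]; rewrite cdom_cmul.
- by move=> [u /= /IHt <- /IHs].
- by move=> /IHs.
Qed.

(** Each element of the hull is built from left multiplications, which
commute with right multiplication. *)
Lemma Il_cmul s x y z : \val s (x, y) -> ctgt z = cdom x ->
  \val s (cmul x z, cmul y z).
Proof.
have := set_mem (valP s); move: (\val s) => u Iu.
elim: Iu x y => {s u} [c|s t Is IHs It IHt|s Is IHs] x y /=.
- by move=> [/= xc ->] zx; rewrite /lmul /= ctgt_cmul // cmulA.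
- move=> [u /= xu uy] zx; exists (cmul u z); first exact: IHt.
  by apply: IHs => //; rewrite (@Il_cdom (to_set_type It) _ _ xu).
- by move=> yx zx; apply: IHs => //; rewrite -(@Il_cdom (to_set_type Is) _ _ yx).
Qed.

Lemma J_right_ideal e x : \val e x -> right_ideal x `<=` \val e.
Proof.
have [s Is es] := set_mem (valP e).
rewrite -es => -[y xy] _ [z /= zx <-]; exists (cmul y z).
exact: (@Il_cmul (to_set_type Is)).
Qed.

Lemma Il_objects s : exists v w, [/\ objects C v, objects C w
  & forall x y, \val s (x, y) -> ctgt x = v /\ ctgt y = w].
Proof.
have := set_mem (valP s); move: (\val s) => u Iu.
elim: Iu => {s u} [c|s t _ [v [w [vO wO sE]]] _ [v' [w' [v'O w'O tE]]]
  |s _ [v [w [vO wO sE]]]].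
- exists (cdom c), (ctgt c); split; [exact: objects_cdom|exact: objects_ctgt|].
  by move=> x y [/= xc ->]; rewrite ctgt_cmul.
- exists v', w; split=> // x y /= [u /= /tE[? _] /sE[_ ?]]; by split.
- by exists w, v; split=> // x y /= /sE[].
Qed.

Definition Ilmul c : Il C := to_set_type (Il_lmul c).

(** The ideal [cC], presented as the range idempotent of left multiplication by
[c]; [Jconj_dom_inv] then pulls it back to the domain. *)
Definition Jideal c : J C := Jdom (sinv (Ilmul c)).

Lemma JidealE c : \val (Jideal c) = right_ideal c.
Proof.
apply/seteqP; split=> x /=; first by move=> [y [/= yc ->]]; exists y.
by move=> [y yc <-]; exists y.
Qed.

Lemma Jdom_Ilmul c : Jdom (Ilmul c) = Jideal (cdom c).
Proof.
apply: J_ext => x; rewrite JidealE right_ideal_object; last exact: objects_cdom.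
by split; [move=> [y []]|move=> xc; exists (cmul c x)].
Qed.

Lemma Jconj_comp s t e (Ist : Il C (\val s \; \val t)) :
  Jconj t (Jconj s e) = Jconj (to_set_type Ist) e.
Proof.
apply: J_ext => x; split.
  move=> /JconjE[y xy /JconjE[z yz ez]]; apply/JconjE; exists z => //=.
  by exists y.
move=> /JconjE[z [y xy yz] ez]; apply/JconjE; exists y; first exact: xy.
by apply/JconjE; exists z; [exact: yz|exact: ez].
Qed.

(** * Characters and their objects *)

Implicit Types chi psi : Jhat C.

Lemma Jhat_meet chi e f :
  \val chi (Jmeet e f) = \val chi e && \val chi f.
Proof. by have [_ ->] := set_mem (valP chi). Qed.

Lemma Jhat_nonempty chi e : \val chi e -> \val e !=set0.
Proof.
have [_ _ chi0] := set_mem (valP chi) => chie; apply/set0P/eqP => /chi0.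
by rewrite chie.
Qed.

Lemma Jhat_subset chi e f : \val e `<=` \val f -> \val chi e -> \val chi f.
Proof.
move=> ef; suff -> : e = Jmeet e f by rewrite Jhat_meet => /andP[].
by apply: J_ext => x; split=> [ex|[]//]; split=> //; exact: ef.
Qed.

(** The domain of an element of the hull lies in the ideal of one object. *)
Lemma Jhat_object chi : exists2 v, objects C v & \val chi (Jideal v).
Proof.
have [[e chie] _ _] := set_mem (valP chi).
have [s Is es] := set_mem (valP e).
have [v [w [vO _ sE]]] := Il_objects (to_set_type Is).
exists v => //; apply: Jhat_subset chie => x.
by rewrite -es JidealE right_ideal_object // => -[y /sE[]].
Qed.

Lemma Jhat_disjoint chi e f :
  \val e `&` \val f = set0 -> \val chi e -> \val chi f = false.
Proof.
move=> ef0 chie; apply/negP => chif.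
have [x] : \val (Jmeet e f) !=set0.
  by apply: (@Jhat_nonempty chi); rewrite Jhat_meet chie.
move=> exf; have : (\val e `&` \val f) x by exact: exf.
by rewrite ef0.
Qed.

Lemma Jhat_object_unique chi v w : objects C v -> objects C w ->
  \val chi (Jideal v) -> \val chi (Jideal w) -> v = w.
Proof.
move=> vO wO chiv; apply: contraPP => vw; rewrite (@Jhat_disjoint _ (Jideal v)) //.
apply/seteqP; split=> // x; rewrite !JidealE => -[].
by rewrite !right_ideal_object // => ->.
Qed.

(** The ideals of the objects are pairwise disjoint, so the choice is unique:
[object_ofE]. *)
Definition object_of chi : C := sval (cid2 (Jhat_object chi)).

Lemma object_of_object chi : objects C (object_of chi).
Proof. by rewrite /object_of; case: cid2. Qed.

Lemma object_of_ideal chi : \val chi (Jideal (object_of chi)).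
Proof. by rewrite /object_of; case: cid2. Qed.

Lemma object_ofE chi v : objects C v -> \val chi (Jideal v) -> object_of chi = v.
Proof.
move=> vO; apply: Jhat_object_unique => //; first exact: object_of_object.
exact: object_of_ideal.
Qed.

Lemma Jhat_ext chi psi : (forall e, \val chi e = \val psi e) -> chi = psi.
Proof. by move=> chipsi; apply/val_inj/funext. Qed.

(** * Filters and maximal characters *)

Lemma filter_char (X : set (J C)) : X !=set0 ->
  (forall e f, X (Jmeet e f) <-> X e /\ X f) ->
  (forall e, X e -> \val e !=set0) ->
  exists chi, forall e, \val chi e <-> X e.
Proof.
move=> [e0 Xe0] XI X0.
have chiP : Jhat C (fun e => `[< X e >]).
  split; first by exists e0; apply/asboolP.
    by move=> e f; rewrite -asbool_and; apply: asbool_equiv_eq.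
  move=> e e0'; apply/asboolP => /X0[x]; by rewrite e0'.
by exists (to_set_type chiP) => e; split=> /asboolP.
Qed.

(** The principal filter at [x]. *)
Lemma point_char x : exists chi, forall e, \val chi e <-> \val e x.
Proof.
apply: filter_char => //; last by move=> e ex; exists x.
exists (Jideal x); rewrite JidealE; exact: right_ideal_refl.
Qed.

(** Zorn's lemma applies since a union of a chain of filters is a filter. *)
Lemma maximal_char_ge chi :
  exists2 psi, maximal_chars psi & supp chi `<=` supp psi.
Proof.
pose T := {psi : Jhat C | supp chi `<=` supp psi}.
pose R (a b : T) := `[< supp (sval a) `<=` supp (sval b) >].
have t0 : T by exists chi.
have [|||[psi chipsi] psimax] := @ZL_preorder T t0 R.
- by move=> a; apply/asboolP.
- by move=> b a c /asboolP ab /asboolP bc; apply/asboolP => e /ab /bc.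
- move=> A Atot; have [->|/set0P[a0 Aa0]] := eqVneq A set0; first by exists t0.
  pose X e := exists2 a, A a & \val (sval a) e.
  have [|||phi phiE] := @filter_char X.
  + have [[e a0e] _ _] := set_mem (valP (sval a0)).
    by exists e, a0.
  + move=> e f; split.
      move=> [a Aa]; rewrite Jhat_meet => /andP[ae af].
      by split; exists a.
    move=> [[a Aa ae] [b Ab bf]].
    have [/asboolP ab|/asboolP ba] := Atot _ _ Aa Ab.
      by exists b => //; rewrite Jhat_meet bf andbT; exact: ab.
    by exists a => //; rewrite Jhat_meet ae; exact: ba.
  + by move=> e [a _ /Jhat_nonempty].
  have chiphi : supp chi `<=` supp phi.
    by move=> e chie; apply/phiE; exists a0 => //; exact: (svalP a0).
  exists (exist _ phi chiphi) => a Aa; apply/asboolP => e ae /=.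
  by apply/phiE; exists a.
exists psi => // phi psiphi; apply/seteqP; split=> //.
have chiphi : supp chi `<=` supp phi by move=> e /chipsi /psiphi.
exact: (asboolW (psimax (exist _ phi chiphi) (asboolT psiphi))).
Qed.

(** Otherwise [f] could be added to the filter of [chi]. *)
Lemma maximal_char_separated chi f : maximal_chars chi -> ~~ \val chi f ->
  exists2 g, \val chi g & \val g `&` \val f = set0.
Proof.
move=> chimax chif; apply: contrapT => nog.
pose X e := exists2 g, \val chi g & \val g `&` \val f `<=` \val e.
have [[e0 chie0] _ _] := set_mem (valP chi).
have [|||psi psiE] := @filter_char X.
- by exists f, e0 => // x [].
- move=> d e; split.
    by move=> [g chig gde]; split; exists g => // x /gde[].
  move=> [[g chig gd] [h chih he]]; exists (Jmeet g h).
    by rewrite Jhat_meet chig.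
  by move=> x [[gx hx] fx]; split; [exact: gd|exact: he].
- move=> e [g chig ge]; apply/set0P/eqP => e0'; apply: nog; exists g => //.
  by apply/seteqP; split=> //; rewrite -e0'.
have chipsi : supp chi `<=` supp psi.
  by move=> e chie; apply/psiE; exists e => // x [].
have : supp psi f by apply/psiE; exists e0 => // x [].
by rewrite (chimax _ chipsi) /supp /= (negbTE chif).
Qed.

Lemma near_eval chi e : \forall psi \near chi, \val psi e = \val chi e.
Proof.
apply/nbhs_set_type; exists [set f : {ptws J C -> bool} | f e = \val chi e] => //.
have : nbhs (\val chi e) [set b | b = \val chi e].
  by apply: open_nbhs_nbhs; split=> //; exact: discrete_open.
exact: (@proj_continuous (J C) (fun=> bool) e (\val chi)).
Qed.

(** A maximal character sends [f] to 0 only when it sends some ideal disjoint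
from [f] to 1, so a basic neighbourhood needs only positive conditions. *)
Lemma maximal_char_nbhs chi (O : set (Jhat C)) : maximal_chars chi -> nbhs chi O ->
  exists2 e, \val chi e & forall psi, \val psi e -> O psi.
Proof.
move=> chimax; rewrite nbhs_set_type => -[W Wchi WO].
(* The filter with base the sets [D(e)], which is to converge to [chi]. *)
pose F : set_system {ptws J C -> bool} := filter_from
  [set e : J C | \val chi e]
  (fun e => (fun psi : Jhat C => \val psi) @` [set psi : Jhat C | \val psi e]).
have Ff : Filter F.
  apply: filter_from_filter; first by have [] := set_mem (valP chi).
  move=> e f chie chif; exists (Jmeet e f); first by rewrite /= Jhat_meet chie.
  move=> _ [psi + <-]; rewrite /= Jhat_meet => /andP[psie psif].
  by split; exists psi.
have : F --> (\val chi : {ptws J C -> bool}).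
  apply/cvg_sup => e U [V] [[D oD <-] /= Dchi] DU.
  suff [f chif fe] : exists2 f, \val chi f & forall psi, \val psi f ->
      \val psi e = \val chi e.
    by exists f => // _ [psi psif <-]; apply: DU; rewrite /= fe.
  have [chie|chie] := boolP (\val chi e); first by exists e.
  have [g chig ge] := maximal_char_separated chimax chie.
  by exists g => // psi; exact: Jhat_disjoint.
move=> /(_ W Wchi)[e chie eW]; exists e => // psi psie.
by apply: WO; apply: eW; exists psi.
Qed.

(** * Closed invariant subspaces *)

(** Membership only constrains finitely many values of the character at a
time. *)
Lemma closed_Omega : closed (Omega C).
Proof.
move=> chi chiO e n f ef chie.
have nb : \forall psi \near chi, \val psi e = \val chi e /\
    forall i, \val psi (f i) = \val chi (f i).
  apply: filterI; first exact: near_eval.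
  by apply: (@filter_forall _ _ _ (nbhs chi)) => i; exact: near_eval.
have [psi [psiO [psie psif]]] := chiO _ nb.
have [|i] := psiO e n f ef; first by rewrite psie.
by rewrite psif; exists i.
Qed.

(** If all [f i] had value 0, some [h] of value 1 would force value 0 at all of
them; the principal character at a point of [e] and [h] then contradicts that
the [f i] cover [e]. *)
Lemma maximal_chars_Omega : maximal_chars (C := C) `<=` Omega C.
Proof.
move=> chi chimax e n f ef chie; apply: contrapT => nof.
have chif i : \val chi (f i) = false by apply/negP => chif; apply: nof; exists i.
have : \forall psi \near chi, forall i, \val psi (f i) = \val chi (f i).
  by apply: (@filter_forall _ _ _ (nbhs chi)) => i; exact: near_eval.
move=> /(maximal_char_nbhs chimax)[h chih hf].
have [x [ex hx]] : \val (Jmeet e h) !=set0.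
  by apply: (@Jhat_nonempty chi); rewrite Jhat_meet chie.
have [psi psiE] := point_char x.
move: ex; rewrite ef => -[i _ /psiE].
by rewrite hf ?chif //; exact/psiE.
Qed.

Lemma dOmega_Omega : dOmega C `<=` Omega C.
Proof.
rewrite (closure_id (Omega C)).1; last exact: closed_Omega.
exact/closureS/maximal_chars_Omega.
Qed.

Lemma Omega_invariant : Defs.invariant (Omega C).
Proof.
move=> s chi h chiO e n f ef /(chiO _ n (fun i => Jconj s (f i))); apply.
apply/seteqP; split=> x.
  move=> /JconjE[y xy]; rewrite ef => -[i _ fy].
  by exists i => //; apply/JconjE; exists y.
move=> [i _ /JconjE[y xy fy]]; apply/JconjE; exists y => //.
by rewrite ef; exists i.
Qed.

Definition strongly_connected :=
  forall v w, objects C v -> objects C w -> hom w v !=set0.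

(** For [c] in [e] and [x] from the object of [chi] to the domain of [c], left
multiplication by [cx] moves [chi] into the characters of [e]. *)
Lemma orbit_meets chi e : strongly_connected -> \val e !=set0 ->
  exists s, \val chi (Jdom s) /\ \val chi (Jconj s e).
Proof.
move=> homC [c ec].
have [x [xc xv]] := homC _ _ (object_of_object chi) (objects_cdom c).
have pv : cdom (cmul c x) = object_of chi by rewrite cdom_cmul.
have xO := object_of_object chi.
exists (Ilmul (cmul c x)); rewrite Jdom_Ilmul pv; split.
  exact: object_of_ideal.
apply: (Jhat_subset _ (object_of_ideal chi)) => y.
rewrite JidealE right_ideal_object // => yv.
apply/JconjE; exists (cmul (cmul c x) y); first by split; rewrite /= ?pv.
apply: (J_right_ideal ec); rewrite -cmulA ?pv // ?xv//.
by apply: right_ideal_cmul; rewrite ctgt_cmul // xv.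
Qed.

Lemma dOmega_smallest : [set: C] !=set0 -> strongly_connected ->
  smallest_nonempty_closed_invariant [set: Jhat C] (dOmega C).
Proof.
move=> [c _] homC; split.
- have [chi _] := point_char c.
  have [psi psimax _] := maximal_char_ge chi.
  by exists psi; exact: subset_closure.
- split; last exact: dOmega_invariant.
  by exists (dOmega C); rewrite ?setIT //; exact: closed_closure.
- move=> X [chi +] [[F cF XE]]; rewrite {X}XE setIT => Fchi Finv.
  rewrite (closure_id F).1 //; apply: closureS => psi psimax; apply: cF => O.
  move=> /(maximal_char_nbhs psimax)[e psie eO].
  have [s [chis chise]] := orbit_meets chi homC (Jhat_nonempty psie).
  exists (act chis); split; last exact: eO.
  exact: Finv.
Qed.

Lemma smallest_in_Omega :
  smallest_nonempty_closed_invariant [set: Jhat C] (dOmega C) ->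
  smallest_nonempty_closed_invariant (Omega C) (dOmega C).
Proof.
move=> [dO0 _ dOmin]; split=> //.
  split; last exact: dOmega_invariant.
  exists (dOmega C); first exact: closed_closure.
  by rewrite setIidl //; exact: dOmega_Omega.
move=> X X0 [[F cF XE] Xinv]; apply: dOmin => //; split=> //.
by exists X; rewrite ?setIT // XE; apply: closedI => //; exact: closed_Omega.
Qed.

(** The characters in Omega that no element of the hull moves into those of
[wC] form a closed invariant set missing some maximal character; hence it is
empty, while it would contain the principal character at [v] if no morphism
went from [v] to [w]. *)
Lemma strongly_connected_of_smallest :
  smallest_nonempty_closed_invariant (Omega C) (dOmega C) -> strongly_connected.
Proof.
move=> [_ _ dOmin] v w vO wO; apply: contrapT => noHom.
(* Invariant, since the pullbacks of [wC] by the hull are stable under it. *)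
pose F := [set chi : Jhat C | forall s, ~~ \val chi (Jconj s (Jideal w))].
have [chi chiE] := point_char v.
have sub : dOmega C `<=` F `&` Omega C.
  apply: dOmin.
    exists chi; split.
      move=> s; apply/negP => /chiE/JconjE[x vx].
      rewrite JidealE right_ideal_object // => xw.
      by apply: noHom; exists x; split=> //; rewrite (Il_cdom vx).
    move=> e n f ef /chiE; rewrite ef => -[i _ fv].
    by exists i; exact/chiE.
  split.
    exists F => // psi psiF s.
    have [phi [/(_ s) + <-]] := psiF _ (near_eval psi (Jconj s (Jideal w))).
    by [].
  move=> s psi psis [psiF psiO]; split; last exact: Omega_invariant.
  move=> t; have Its : Il C (\val t \; \val s).
    by apply: Il_comp; exact/set_mem/valP.
  by rewrite /= (Jconj_comp _ Its); exact: psiF.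
have [phi phiE] := point_char w.
have [psi psimax phipsi] := maximal_char_ge phi.
have [/(_ (Ilmul w)) + _] := sub psi (subset_closure psimax).
have -> : Jconj (Ilmul w) (Jideal w) = Jideal w.
  by rewrite Jconj_dom_inv Jdom_Ilmul wO.
move=> /negP; apply; apply: phipsi; apply/phiE.
by rewrite JidealE; exact: right_ideal_refl.
Qed.

(** * The boundary *)

Lemma dOmega_near_eval (chi : dOmega C) e :
  \forall psi \near chi, \val (\val psi) e = \val (\val chi) e.
Proof.
apply/nbhs_set_type; exists [set psi | \val psi e = \val (\val chi) e] => //.
exact: near_eval.
Qed.

Lemma dOmega_dense (chi : dOmega C) (O : set (dOmega C)) : nbhs chi O ->
  exists2 psi, O psi & maximal_chars (\val psi).
Proof.
rewrite nbhs_set_type => -[W Wchi WO].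
have [psi [psimax Wpsi]] := set_mem (valP chi) W Wchi.
by exists (to_set_type (subset_closure psimax)) => //; exact: WO.
Qed.

Lemma dOmega_nbhs_ideal (chi : dOmega C) (O : set (dOmega C)) : nbhs chi O ->
  exists2 e, \val e !=set0 & forall psi : dOmega C, \val (\val psi) e -> O psi.
Proof.
move=> /nbhs_interior/dOmega_dense[psi].
rewrite /interior nbhs_set_type => -[W Wpsi WO] psimax.
have [e psie eW] := maximal_char_nbhs psimax Wpsi.
exists e; first exact: Jhat_nonempty psie.
by move=> phi phie; apply/WO/eW.
Qed.

(** A cluster point exists in the product of copies of [bool] by Tychonoff's
theorem. Being a character only involves finitely many coordinates at a time,
apart from the existence of an ideal of value 1, which [e] provides. *)
Lemma compact_dOmega_ideal e : compact [set chi : dOmega C | \val (\val chi) e].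
Proof.
move=> F Fp Fe.
pose v (chi : dOmega C) : {ptws J C -> bool} := \val (\val chi).
have [f [_ fF]] : [set f : {ptws J C -> bool} | forall i, setT (f i)] `&`
    cluster (v @ F) !=set0.
  apply: (@tychonoff (J C) (fun=> bool) (fun=> setT)).
  - by move=> _; exact: bool_compact.
  - exact: filterS filterT.
have nf (a : J C) :
    nbhs (f : {ptws J C -> bool}) [set g : {ptws J C -> bool} | g a = f a].
  have : nbhs (f a) [set b | b = f a].
    by apply: open_nbhs_nbhs; split=> //; exact: discrete_open.
  exact: (@proj_continuous (J C) (fun=> bool) a f).
have Fv A : F A -> (v @ F) (v @` A).
  by move=> FA; apply: (@filterS _ F _ A) => // chi Achi; exists chi.
have fP : Jhat C f.
  split.
  - exists e; have [_ [[chi chie <-]] /= <-] := fF _ _ (Fv _ Fe) (nf e).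
    exact: chie.
  - move=> a b.
    have [_ [[chi _ <-] [[fa fb] fab]]] := fF _ _ (Fv _ filterT)
      (filterI (filterI (nf a) (nf b)) (nf (Jmeet a b))).
    by rewrite -fa -fb -fab; exact: Jhat_meet.
  - move=> a a0; have [_ [[chi _ <-]] /= <-] := fF _ _ (Fv _ filterT) (nf a).
    by have [_ _ chi0] := set_mem (valP (\val chi)); exact: chi0.
pose phi : Jhat C := to_set_type fP.
have phiO : dOmega C phi.
  apply: closed_closure => O /nbhs_set_type[W Wphi WO].
  have [_ [[chi _ <-] Wchi]] := fF _ _ (Fv _ filterT) Wphi.
  by exists (\val chi); split; [exact/set_mem/valP|exact: WO].
exists (to_set_type phiO); split.
  have [_ [[chi chie <-]] /= fe] := fF _ _ (Fv _ Fe) (nf e).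
  by rewrite /= -fe.
move=> A O FA /nbhs_set_type[W /nbhs_set_type[V Vphi VW] WO].
have [_ [[chi Achi <-] Vchi]] := fF _ _ (Fv _ FA) Vphi.
by exists chi; split => //; exact/WO/VW.
Qed.

(** Near the second character there is a maximal one, and it contains an
ideal disjoint from [e]. *)
Lemma disjoint_ideals_of_points (chi psi : dOmega C) v e : objects C v ->
  \val (\val chi) (Jideal v) -> \val (\val psi) (Jideal v) ->
  \val (\val chi) e -> ~~ \val (\val psi) e ->
  exists a b, [/\ right_ideal v a, right_ideal v b
                & right_ideal a `&` right_ideal b = set0].
Proof.
move=> vO chiv psiv chie psie.
have [phi [phiv phie] phimax] := dOmega_dense
  (filterI (dOmega_near_eval psi (Jideal v)) (dOmega_near_eval psi e)).
have [|g phig ge] := @maximal_char_separated _ e phimax; first by rewrite phie.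
have [a [ae av]] : \val (Jmeet e (Jideal v)) !=set0.
  by apply: (@Jhat_nonempty (\val chi)); rewrite Jhat_meet chie.
have [b [bg bv]] : \val (Jmeet g (Jideal v)) !=set0.
  by apply: (@Jhat_nonempty (\val phi)); rewrite Jhat_meet phig phiv.
rewrite !JidealE in av bv; exists a, b; split=> //.
apply/seteqP; split=> // x [/(J_right_ideal ae) ex /(J_right_ideal bg) gx].
by rewrite -ge.
Qed.

(** * Bisections of the groupoid of germs *)

Lemma germ_surj (g : transformation_groupoid C) :
  exists s (chi : dOmega C) (h : \val (\val chi) (Jdom s)), g = germ h.
Proof.
exists (\val (repr g)).1, (\val (repr g)).2, (set_mem (valP (repr g))).
rewrite -[LHS]reprK /germ; congr (\pi_(transformation_groupoid C) _)%qT.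
by apply/val_inj => /=; case: (\val (repr g)).
Qed.

Lemma germ_source_open (W : set (transformation_groupoid C)) :
  open W -> open (@germ_source C @` W).
Proof.
rewrite germ_openE => oW.
suff -> : @germ_source C @` W = \bigcup_s germ_trace W s.
  by apply: bigcup_open => s _; exact: oW.
apply/seteqP; split=> chi.
  move=> [g Wg <-]; have [s [psi [h gE]]] := germ_surj g.
  by exists s => //; move: Wg; rewrite gE germ_sourceE; exists h.
by move=> [s _ [h Wh]]; exists (germ h) => //; exact: germ_sourceE.
Qed.

(** The source map restricts to a homeomorphism from such a set onto its
image. *)
Lemma compact_of_source (W : set (transformation_groupoid C)) :
  open W -> set_inj W (@germ_source C) -> compact (@germ_source C @` W) ->
  compact W.
Proof.
move=> oW Winj cW F Fp FW.
have FA A : F A -> (@germ_source C @ F) (@germ_source C @` (A `&` W)).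
  move=> FA; apply: (@filterS _ F _ (A `&` W)); last exact: filterI.
  by move=> g AWg; exists g.
have sFW : (@germ_source C @ F) (@germ_source C @` W).
  by have := FA _ FW; rewrite setIid.
have [_ [[g Wg <-] gF]] := cW _ (fmap_proper_filter (@germ_source C) Fp) sFW.
exists g; split=> // A O FA' gO.
have [V [oV Vg VO]] : exists V, [/\ open V, V g & V `<=` O `&` W].
  exists ((O `&` W)°); split; [exact: open_interior| |exact: interior_subset].
  by apply: filterI => //; exact: open_nbhs_nbhs.
have : nbhs (germ_source g) (@germ_source C @` V).
  by apply: open_nbhs_nbhs; split; [exact: germ_source_open|exists g].
move=> /(gF _ _ (FA _ FA'))[_ [[h [Ah Wh] <-] [k Vk kh]]].
have [Ok Wk] := VO _ Vk.
by exists h; split=> //; rewrite -(Winj _ _ (mem_set Wk) (mem_set Wh) kh).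
Qed.

(** The values of a character at all ideals are determined inside the domain
of [s], where [s] can be undone. *)
Lemma act_inj s chi psi (h : \val chi (Jdom s)) (k : \val psi (Jdom s)) :
  act h = act k -> chi = psi.
Proof.
move=> hk; apply: Jhat_ext => e.
have : \val (act h) (Jconj (sinv s) e) = \val (act k) (Jconj (sinv s) e).
  by rewrite hk.
by rewrite /= !Jconj_inv !Jhat_meet h k !andbT.
Qed.

Lemma germ_range_ideal p (chi : dOmega C)
    (h : \val (\val chi) (Jdom (Ilmul p))) :
  \val (\val (germ_range (germ h))) (Jideal p).
Proof. by rewrite germ_rangeE /= Jconj_dom_inv. Qed.

(** The germs that move each point of [B], living at an object [w], by left
multiplication by [p w]. *)
Definition translates (B : set (dOmega C)) (p : C -> C) :
    set (transformation_groupoid C) :=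
  \bigcup_w (germs (Ilmul (p w)) `&`
    [set g | B (germ_source g) /\ object_of (\val (germ_source g)) = w]).

Lemma translates_germ (B : set (dOmega C)) p (g : transformation_groupoid C) :
  translates B p g -> exists w (chi : dOmega C)
    (h : \val (\val chi) (Jdom (Ilmul (p w)))),
    [/\ B chi, object_of (\val chi) = w & g = germ h].
Proof.
move=> [w _ [[chi [h ->]] [/= +]]]; rewrite germ_sourceE => Bchi chiw.
by exists w, chi, h.
Qed.

Lemma source_translates (B : set (dOmega C)) (p : C -> C) :
  (forall w, objects C w -> cdom (p w) = w) ->
  @germ_source C @` translates B p = B.
Proof.
move=> pE; apply/seteqP; split=> chi.
  by move=> [g /translates_germ[w [psi [h [Bpsi _ ->]]]] <-]; rewrite germ_sourceE.
move=> Bchi; set w := object_of (\val chi).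
have h : \val (\val chi) (Jdom (Ilmul (p w))).
  rewrite Jdom_Ilmul pE; first exact: object_of_ideal.
  exact: object_of_object.
exists (germ h); last exact: germ_sourceE.
by exists w => //; split; [exists chi, h|rewrite /= germ_sourceE].
Qed.

Lemma near_object (chi : dOmega C) :
  \forall psi \near chi, object_of (\val psi) = object_of (\val chi).
Proof.
have := dOmega_near_eval chi (Jideal (object_of (\val chi))).
apply: filterS => psi psiE; apply: object_ofE; first exact: object_of_object.
by rewrite psiE; exact: object_of_ideal.
Qed.

(** The source determines the object and hence the multiplier; so does the
range, because it lives in the ideal of the multiplier and these ideals are
disjoint. *)
Lemma translates_bisection (B : set (dOmega C)) (p : C -> C) :
  compact B -> open B -> (forall w, objects C w -> cdom (p w) = w) ->
  (forall chi psi : dOmega C, B chi -> B psi ->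
    object_of (\val chi) <> object_of (\val psi) ->
    right_ideal (p (object_of (\val chi))) `&`
    right_ideal (p (object_of (\val psi))) = set0) ->
  compact_open_bisection (@germ_source C) (@germ_range C) (translates B p).
Proof.
move=> cB oB pE pdisj.
have oU : open (translates B p).
  apply: bigcup_open => w _.
  apply/(@open_sub_germs _ (Ilmul (p w))); first by move=> g [].
  pose Bw := B `&` [set chi : dOmega C | object_of (\val chi) = w].
  suff -> : @germ_source C @` (germs (Ilmul (p w)) `&`
      [set g | B (germ_source g) /\ object_of (\val (germ_source g)) = w]) = Bw.
    apply: openI => //; rewrite openE => chi chiw.
    by have := near_object chi; apply: filterS => psi; rewrite chiw.
  apply/seteqP; split=> [_ [g [_ ?] <-] //|chi [Bchi chiw]].
  have [g [w' _ [gp gB]] gchi] : (@germ_source C @` translates B p) chi.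
    by rewrite source_translates.
  exists g => //; split; last by rewrite /= gchi.
  by move: gp; rewrite -gB.2 gchi chiw.
have Uinj : set_inj (translates B p) (@germ_source C).
  move=> g g' /set_mem/translates_germ[w [chi [h [Bchi chiw ->]]]].
  move=> /set_mem/translates_germ[w' [psi [k [Bpsi psiw ->]]]].
  rewrite !germ_sourceE => chipsi; apply/germP; split=> //.
  exists (Jideal w); first by rewrite -chiw; exact: object_of_ideal.
  by rewrite -chiw -psiw chipsi.
split=> //; first by apply: compact_of_source => //; rewrite source_translates.
move=> g g' /set_mem/translates_germ[w [chi [h [Bchi chiw ->]]]].
move=> /set_mem/translates_germ[w' [psi [k [Bpsi psiw ->]]]] hk.
have ww' : w = w'.
  apply: contrapT => ww'.
  have : \val (\val (germ_range (germ k))) (Jideal (p w)).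
    by rewrite -hk; exact: germ_range_ideal.
  rewrite (@Jhat_disjoint _ (Jideal (p w'))) //; last exact: germ_range_ideal.
  by rewrite !JidealE -chiw -psiw; apply: pdisj => //; rewrite chiw psiw => /esym.
case: _ / ww' in k psiw hk *.
move: hk; rewrite !germ_rangeE => /(congr1 val)/= /act_inj/val_inj chipsi.
apply/germP; split=> //; exists (Jdom (Ilmul (p w))) => //.
Qed.

(** * Pure infiniteness *)

Definition disjoint_right_multiples := forall v, objects C v -> exists a b,
  [/\ right_ideal v a, right_ideal v b & right_ideal a `&` right_ideal b = set0].

(** From [c], keep one of two disjoint right multiples and branch again below
the other. *)
Lemma disjoint_ideals_seq c : disjoint_right_multiples ->
  exists r : nat -> C, (forall n, right_ideal c (r n)) /\
    forall m n, m <> n -> right_ideal (r m) `&` right_ideal (r n) = set0.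
Proof.
move=> pairs.
have /choice[k kP] : forall d, exists ab : C * C,
    [/\ ctgt ab.1 = cdom d, ctgt ab.2 = cdom d
      & right_ideal ab.1 `&` right_ideal ab.2 = set0].
  move=> d; have dO := objects_cdom d.
  by have [a [b []]] := pairs _ dO; rewrite !right_ideal_object //; exists (a, b).
pose c_ n := iter n (fun d => cmul d (k d).2) c.
have cS n : right_ideal (c_ n) (c_ n.+1).
  by apply: right_ideal_cmul; have [] := kP (c_ n).
have c_le m n : m <= n -> right_ideal (c_ m) (c_ n).
  elim: n => [|n IHn]; first by rewrite leqn0 => /eqP ->; exact: right_ideal_refl.
  rewrite leq_eqVlt => /predU1P[->|/IHn mn]; first exact: right_ideal_refl.
  exact: right_ideal_trans mn _ (cS n).
pose r n := cmul (c_ n) (k (c_ n)).1.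
have c_r n : right_ideal (c_ n) (r n).
  by apply: right_ideal_cmul; have [] := kP (c_ n).
have lt_disj m n : m < n -> right_ideal (r m) `&` right_ideal (r n) = set0.
  move=> mn; have [ka kb kab] := kP (c_ m).
  have := cmul_right_ideals_disjoint ka kb kab.
  apply: subsetI_eq0 => //; apply: right_ideal_trans.
  exact: right_ideal_trans (c_le _ _ mn) _ (c_r n).
exists r; split=> [n|m n].
  exact: right_ideal_trans (c_le 0 n isT) _ (c_r n).
have [mn _|nm _|-> //] := ltngtP m n; first exact: lt_disj.
by rewrite setIC; exact: lt_disj.
Qed.

(** Numbering by [i] the finitely many objects met by [B], the two bisections
use the even and the odd terms of one sequence of disjoint ideals, so that
their ranges are disjoint as well. *)
Lemma purely_infinite_of_disjoint_multiples :
  strongly_connected -> disjoint_right_multiples ->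
  purely_infinite (@germ_source C) (@germ_range C).
Proof.
move=> homC pairs B cB oB.
have [->|/set0P[chi0 Bchi0]] := eqVneq B set0.
  exists set0, set0; split; rewrite ?image_set0 ?setI0 ?setU0 //.
  by split; split; by [exact: compact0|exact: open0|move=> g g'; rewrite inE].
have [e [c ec] eB] := dOmega_nbhs_ideal (open_nbhs_nbhs (conj oB Bchi0)).
have [r [cr rdisj]] := disjoint_ideals_seq c pairs.
have /finite_set_countable/countable_injP[i iinj] :=
  compact_locally_constant cB near_object.
(* [q (w, n)] goes from [w] to the domain of [r n]. *)
have /choice[q qP] : forall wn : C * nat, exists y, objects C wn.1 ->
    ctgt y = cdom (r wn.2) /\ cdom y = wn.1.
  move=> [w n] /=; have [wO|?] := pselect (objects C w); last by exists w.
  by have [y yP] := homC _ _ wO (objects_cdom (r n)); exists y.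
pose p b w := let n := b + (i w).*2 in cmul (r n) (q (w, n)).
have pdom b w : objects C w -> cdom (p b w) = w.
  by move=> wO; have [qr qw] := qP (w, b + (i w).*2) wO; rewrite cdom_cmul.
have p_r b w : objects C w -> right_ideal (r (b + (i w).*2)) (p b w).
  by move=> wO; have [qr _] := qP (w, b + (i w).*2) wO; exact: right_ideal_cmul.
have pdisj b b' v w : objects C v -> objects C w ->
    b + (i v).*2 <> b' + (i w).*2 ->
    right_ideal (p b v) `&` right_ideal (p b' w) = set0.
  by move=> vO wO /rdisj; apply: subsetI_eq0; apply: right_ideal_trans; exact: p_r.
have bis (b : bool) : compact_open_bisection (@germ_source C) (@germ_range C)
    (translates B (p b)).
  apply: translates_bisection => // [|chi psi Bchi Bpsi chipsi]; first exact: pdom.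
  apply: pdisj; [exact: object_of_object|exact: object_of_object|].
  move=> /addnI/double_inj/iinj chipsi'; apply: chipsi.
  by apply: chipsi'; apply/mem_set; [exists chi|exists psi].
have rangeB (b : bool) : @germ_range C @` translates B (p b) `<=` B.
  move=> _ [_ /translates_germ[w [chi [h [_ chiw ->]]]] <-]; apply: eB.
  apply: Jhat_subset (germ_range_ideal h); rewrite JidealE.
  have wO : objects C w by rewrite -chiw; exact: object_of_object.
  move=> x xp; apply: (J_right_ideal ec); apply: right_ideal_trans (cr _) _ _.
  exact: right_ideal_trans (p_r _ _ wO) _ xp.
exists (translates B (p false)), (translates B (p true)); split.
- by split; exact: bis.
- exact/source_translates/pdom.
- exact/source_translates/pdom.
- by rewrite subUset; split; exact: rangeB.
apply/seteqP; split=> // psi [].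
move=> [_ /translates_germ[v [chi [h [_ chiv ->]]]] <-].
move=> [_ /translates_germ[w [phi [k [_ phiw ->]]]] hk].
have := germ_range_ideal h; rewrite -hk (@Jhat_disjoint _ (Jideal (p true w))) //.
  rewrite !JidealE; apply: pdisj; rewrite -?chiv -?phiw; try exact: object_of_object.
  by move=> /(congr1 odd); rewrite !oddD !odd_double.
exact: germ_range_ideal.
Qed.

(** If no ideals as required exist, any two boundary points of [D(vC)]
coincide; but the disjoint ranges of the two bisections lie in that set. *)
Lemma disjoint_multiples_of_purely_infinite :
  purely_infinite (@germ_source C) (@germ_range C) -> disjoint_right_multiples.
Proof.
move=> pinf v vO.
have [] := pinf _ (@compact_dOmega_ideal (Jideal v)).
  exact: open_Jhat_eval.
move=> U [V [_ sU sV rB rUV]].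
have [chi0 chi0v] := point_char v.
have [psi0 psi0max psi0v] := maximal_char_ge chi0.
pose psi : dOmega C := to_set_type (subset_closure psi0max).
have psiv : \val (\val psi) (Jideal v).
  by apply: psi0v; apply/chi0v; rewrite JidealE; exact: right_ideal_refl.
have [g Ug _] : (@germ_source C @` U) psi by rewrite sU.
have [h Vh _] : (@germ_source C @` V) psi by rewrite sV.
have gv : \val (\val (germ_range g)) (Jideal v) by apply: rB; left; exists g.
have hv : \val (\val (germ_range h)) (Jideal v) by apply: rB; right; exists h.
apply: contrapT => nopair.
suff gh : germ_range g = germ_range h.
  have : (@germ_range C @` U `&` @germ_range C @` V) (germ_range g).
    by split; [exists g|rewrite gh; exists h].
  by rewrite rUV.
apply/val_inj/Jhat_ext => e; apply/idP/idP => ee; apply: contrapT => /negP e'.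
  exact: nopair (disjoint_ideals_of_points vO gv hv ee e').
exact: nopair (disjoint_ideals_of_points vO hv gv ee e').
Qed.

End Category.

Theorem proposition5p21 (C : lc_category) (C_neq0 : [set: C] !=set0) :
  let condA := smallest_nonempty_closed_invariant [set: Jhat C] (dOmega C) in
  let condB := smallest_nonempty_closed_invariant (Omega C) (dOmega C) in
  let condC := forall v w : C, objects C v -> objects C w -> hom w v !=set0 in
  [/\ condA <-> condB, condB <-> condC
    & condC ->
      (purely_infinite (@germ_source C) (@germ_range C) <->
       forall v : C, objects C v ->
         exists a b : C, [/\ right_ideal v a, right_ideal v b
                           & right_ideal a `&` right_ideal b = set0])].
Proof.
move=> condA condB condC.
have AB : condA -> condB by exact: smallest_in_Omega.
have BC : condB -> condC by exact: strongly_connected_of_smallest.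
have CA : condC -> condA by exact: dOmega_smallest.
split; [by split=> // /BC/CA|by split=> // /CA/AB|].
move=> homC; split; first exact: disjoint_multiples_of_purely_infinite.
exact: purely_infinite_of_disjoint_multiples.
Qed.
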